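(* Let $k$ be an algebraically closed field of characteristic zero, let $A$ be a finite-dimensional unital associative $k$-algebra, let $\Delta\in A$ and let $B=\widehat{A}_\Delta$ be the augmented homotope, with augmentation ideal $B^+$. If $B^+$ is projective as a right $B$-module and as a left $B$-module, then the multiplication map $B^+\otimes_k B^+\to B^+$ is surjective, and hence $A\Delta A=A$, where $A\Delta A$ is the two-sided ideal of $A$ generated by $\Delta$.
   Context: For a unital associative $k$-algebra $A$ and $\Delta\in A$, the homotope $A_\Delta$ is the vector space $A$ with the multiplication $a *_\Delta b = a\Delta b$. The augmented homotope $B=\widehat{A}_\Delta = k\cdot 1\oplus A_\Delta$ is obtained by externally adjoining a unit to $A_\Delta$. The augmentation $\epsilon:B\to k$ is the algebra homomorphism killing $A_\Delta$, and $B^+=\ker\epsilon=A_\Delta$. The multiplication map $B^+\otimes_k B^+\to B^+$ is the multiplication of $B$, that is $a\otimes b\mapsto a\Delta b$. *)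

(* Defs.v *)
From HB Require Import structures.
From mathcomp Require Import all_boot all_order all_algebra all_field.

Set Implicit Arguments.
Unset Strict Implicit.
Unset Printing Implicit Defensive.

Import GRing.Theory.
Local Open Scope ring_scope.

(* Finite-dimensional unital associative algebras. The library's falgType is
   built over nzRingType and so excludes the zero algebra; here 1 = 0 is
   allowed. *)
Record fdAlgType (K : fieldType) := FdAlgType {
  fdalg_space : vectType K;
  fdalg_mul : {bilinear fdalg_space -> fdalg_space -> fdalg_space};
  fdalg_one : fdalg_space;
  fdalg_mulA : forall a b c,
    fdalg_mul a (fdalg_mul b c) = fdalg_mul (fdalg_mul a b) c;
  fdalg_mul1 : forall a, fdalg_mul fdalg_one a = a;
  fdalg_mule1 : forall a, fdalg_mul a fdalg_one = a
}.

Section FdAlgTheory.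
Variables (K : fieldType) (A : fdAlgType K).

Definition fdalg_sort : Type := fdalg_space A.
HB.instance Definition _ := Vector.on fdalg_sort.

Let mul : fdalg_sort -> fdalg_sort -> fdalg_sort := @fdalg_mul K A.

Fact fdalg_mulDl : left_distributive mul +%R.
Proof. by move=> a b c; rewrite /mul linearDl. Qed.
Fact fdalg_mulDr : right_distributive mul +%R.
Proof. by move=> a b c; rewrite /mul linearDr. Qed.

HB.instance Definition _ := GRing.Zmodule_isPzRing.Build fdalg_sort
  (@fdalg_mulA K A) (@fdalg_mul1 K A) (@fdalg_mule1 K A)
  fdalg_mulDl fdalg_mulDr.

Lemma fdalg_scaleAl (c : K) (a b : fdalg_sort) : c *: (a * b) = (c *: a) * b.
Proof. exact/esym/(linearZl_LR (@fdalg_mul K A)). Qed.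
Lemma fdalg_scaleAr (c : K) (a b : fdalg_sort) : c *: (a * b) = a * (c *: b).
Proof. exact/esym/(linearZr_LR (@fdalg_mul K A)). Qed.

End FdAlgTheory.

Coercion fdalg_sort : fdAlgType >-> Sortclass.

Section FalgFdAlg.
Variables (K : fieldType) (L : falgType K).

Fact falg_mul_bilinear : bilinear_for *:%R *:%R ( *%R : L -> L -> L).
Proof.
by split=> z c x y; rewrite /= ?mulrDl ?mulrDr -?scalerAl -?scalerAr.
Qed.
HB.instance Definition _ :=
  bilinear_isBilinear.Build K L L L *:%R *:%R ( *%R : L -> L -> L)
    falg_mul_bilinear.

Definition falg_fdAlg : fdAlgType K :=
  @FdAlgType K L ( *%R : L -> L -> L) 1 (@mulrA L) (@mul1r L) (@mulr1 L).

End FalgFdAlg.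

(* Right R-modules are left modules over the converse ring, lmodType R^c. *)
Definition projective (R : pzRingType) (P : lmodType R) : Prop :=
  forall (M N : lmodType R) (p : {linear M -> N}) (f : {linear P -> N}),
    (forall y : N, exists x : M, p x = y) ->
    exists g : {linear P -> M}, forall x : P, p (g x) = f x.

Section Ideal.
Variable A : pzRingType.

Record two_sided_ideal (I : A -> Prop) : Prop := TwoSidedIdeal {
  ideal0 : I 0;
  idealB : forall x y, I x -> I y -> I (x - y);
  idealMl : forall a x, I x -> I (a * x);
  idealMr : forall a x, I x -> I (x * a)
}.

Definition generated_ideal (d : A) (a : A) : Prop :=
  forall I : A -> Prop, two_sided_ideal I -> I d -> I a.

Lemma generated_ideal_ideal d : two_sided_ideal (generated_ideal d).
Proof.
split=> [I iI _|x y Ix Iy I iI Id|a x Ix I iI Id|a x Ix I iI Id].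
- exact: ideal0.
- by apply: idealB => //; [exact: Ix | exact: Iy].
- by apply: idealMl => //; exact: Ix.
- by apply: idealMr => //; exact: Ix.
Qed.

Lemma generated_idealP (d a : A) :
  generated_ideal d a <->
  exists n (x y : 'I_n -> A), a = \sum_(i < n) x i * d * y i.
Proof.
pose sums a := exists n (x y : 'I_n -> A), a = \sum_(i < n) x i * d * y i.
split=> [gen_a|[n [x [y ->]]] I iI Id]; last first.
  elim/big_rec: _ => [|i z _ Iz]; first exact: ideal0.
  rewrite -[z]opprK -[- z]add0r; apply: (idealB iI); last first.
    by apply: (idealB iI) => //; exact: ideal0.
  by apply: (idealMr iI); apply: (idealMl iI).
apply: (gen_a sums); last by exists 1%N, (fun=> 1), (fun=> 1); rewrite big_ord1 mul1r mulr1.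
split.
- by exists 0%N, (fun=> 0), (fun=> 0); rewrite big_ord0.
- move=> _ _ [m [x [y ->]]] [n [z [t ->]]].
  exists (m + n)%N, (fun i => match split i with inl j => x j | inr j => - z j end),
    (fun i => match split i with inl j => y j | inr j => t j end).
  rewrite big_split_ord /= -sumrN; congr (_ + _); apply: eq_bigr => i _.
    by case: splitP => j /= ij; rewrite ?(ord_inj ij) //;
       have := ltn_ord i; rewrite ij ltnNge leq_addr.
  case: splitP => j /= ij.
    by have := ltn_ord j; rewrite -ij ltnNge leq_addr.
  by move/addnI/ord_inj: ij => ->; rewrite !mulNr.
- move=> b _ [n [x [y ->]]]; exists n, (fun i => b * x i), y.
  by rewrite mulr_sumr; apply: eq_bigr => i _; rewrite !mulrA.
- move=> b _ [n [x [y ->]]]; exists n, x, (fun i => y i * b).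
  by rewrite mulr_suml; apply: eq_bigr => i _; rewrite !mulrA.
Qed.

End Ideal.

(* The tensor product over K of two finite-dimensional spaces, realized on
   coordinate matrices with respect to the bases chosen by vbasis; its
   universal property is tensor_liftE and tensor_lift_uniq. *)
Section Tensor.
Variables (K : fieldType) (U V : vectType K).

Definition tensor_space : Type := 'M[K]_(\dim {:U}, \dim {:V}).
HB.instance Definition _ := Vector.on tensor_space.

Definition tensor (u : U) (v : V) : tensor_space :=
  \matrix_(i, j) (coord (vbasis {:U}) i u * coord (vbasis {:V}) j v).

Fact tensor_bilinear : bilinear_for *:%R *:%R tensor.
Proof.
by split=> z c x y; apply/matrixP=> i j;
  rewrite !mxE linearP /= ?mulrDl ?mulrDr ?mulrA // [_ * c]mulrC.
Qed.
HB.instance Definition _ :=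
  bilinear_isBilinear.Build K U V tensor_space *:%R *:%R tensor
    tensor_bilinear.

Variable W : vectType K.
Implicit Type f : {bilinear U -> V -> W}.

Definition tensor_lift f (t : tensor_space) : W :=
  \sum_i \sum_j t i j *: f (vbasis {:U})`_i (vbasis {:V})`_j.

Fact tensor_lift_linear f : linear (tensor_lift f).
Proof.
move=> c s t; rewrite /tensor_lift scaler_sumr -big_split; apply: eq_bigr=> i _.
rewrite scaler_sumr -big_split; apply: eq_bigr=> j _ /=.
by rewrite !mxE scalerDl scalerA.
Qed.
HB.instance Definition _ f :=
  GRing.isLinear.Build K tensor_space W *:%R (tensor_lift f)
    (tensor_lift_linear f).

Lemma tensor_liftE f u v : tensor_lift f (tensor u v) = f u v.
Proof.
rewrite [in RHS](coord_vbasis (memvf u)) linear_sumlz /=.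
apply: eq_bigr => i _; rewrite linearZl_LR /=.
rewrite [in RHS](coord_vbasis (memvf v)) linear_sumr /= scaler_sumr.
by apply: eq_bigr => j _; rewrite mxE linearZr_LR /= scalerA.
Qed.

Lemma tensor_lift_uniq f (g : {linear tensor_space -> W}) :
  (forall u v, g (tensor u v) = f u v) -> g =1 tensor_lift f.
Proof.
move=> gE t.
suff -> : t = \sum_i \sum_j
    t i j *: tensor (vbasis {:U})`_i (vbasis {:V})`_j.
  rewrite linear_sum [RHS]linear_sum; apply: eq_bigr => i _.
  rewrite linear_sum [RHS]linear_sum; apply: eq_bigr => j _.
  by rewrite !linearZ /= gE tensor_liftE.
have freeU := basis_free (vbasisP {:U}); have freeV := basis_free (vbasisP {:V}).
rewrite {1}[t]matrix_sum_delta; apply: eq_bigr => i _; apply: eq_bigr => j _.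
apply/matrixP => p q.
by rewrite !mxE !coord_free // -natrM mulnb [i == p]eq_sym [j == q]eq_sym.
Qed.

End Tensor.

Section AugmentedHomotope.

Let pair_ext (T1 T2 : Type) (x y : T1 * T2) : x.1 = y.1 -> x.2 = y.2 -> x = y.
Proof. by case: x y => [? ?] [? ?] /= -> ->. Qed.

Variable K : fieldType.

(* (c, a) stands for c 1 + a, with a in the homotope. The parameter d, unused
   in the carrier, selects the multiplication. *)
Definition aug_homotope (A : fdAlgType K) (d : A) : Type := (K^o * A)%type.

Variables (A : fdAlgType K) (d : A).
Local Notation B := (aug_homotope d).
HB.instance Definition _ := Vector.on B.

Definition aug_homotope_one : B := (1, 0).
Definition aug_homotope_mul (x y : B) : B :=
  (x.1 * y.1, x.1 *: y.2 + y.1 *: x.2 + x.2 * d * y.2).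

Local Notation one := aug_homotope_one.
Local Notation mul := aug_homotope_mul.

Fact aug_homotope_mulA : associative mul.
Proof.
move=> [a u] [b v] [c w]; apply: pair_ext => /=; first by rewrite mulrA.
rewrite !(scalerDr, mulrDr, mulrDl, scalerA).
rewrite -!(fdalg_scaleAl, fdalg_scaleAr) !mulrA.
rewrite [c * a]mulrC [c * b]mulrC -!addrA; congr (_ + (_ + _)).
rewrite addrCA; congr (_ + _).
by rewrite (addrCA (b *: _)) addrCA.
Qed.

Fact aug_homotope_mul1 : left_id one mul.
Proof.
by move=> [a u]; apply: pair_ext => /=;
  rewrite ?mul1r // scale1r scaler0 !mul0r !addr0.
Qed.

Fact aug_homotope_mule1 : right_id one mul.
Proof.
by move=> [a u]; apply: pair_ext => /=;
  rewrite ?mulr1 // scale1r scaler0 mulr0 add0r addr0.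
Qed.

Fact aug_homotope_mulDl : left_distributive mul +%R.
Proof.
move=> [a u] [b v] [c w]; apply: pair_ext => /=; first by rewrite mulrDl.
by rewrite scalerDl scalerDr !mulrDl [RHS]addrACA (addrACA (_ *: _)).
Qed.

Fact aug_homotope_mulDr : right_distributive mul +%R.
Proof.
move=> [a u] [b v] [c w]; apply: pair_ext => /=; first by rewrite mulrDr.
by rewrite scalerDl scalerDr !mulrDr [RHS]addrACA (addrACA (_ *: _)).
Qed.

Fact aug_homotope_oner_neq0 : one != 0.
Proof. by apply/eqP => -[/eqP]; rewrite oner_eq0. Qed.

HB.instance Definition _ := GRing.Zmodule_isNzRing.Build B
  aug_homotope_mulA aug_homotope_mul1 aug_homotope_mule1
  aug_homotope_mulDl aug_homotope_mulDr aug_homotope_oner_neq0.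

Fact aug_homotope_scaleAl (c : K) (x y : B) : c *: (x * y) = (c *: x) * y.
Proof.
move: x y => [a u] [b v]; apply: pair_ext => /=; first by rewrite scalerAl.
rewrite !scalerDr !scalerA -!fdalg_scaleAl; congr (_ + _ *: _ + _).
exact: mulrC.
Qed.

Fact aug_homotope_scaleAr (c : K) (x y : B) : c *: (x * y) = x * (c *: y).
Proof.
move: x y => [a u] [b v]; apply: pair_ext => /=; first by rewrite scalerAr.
rewrite !scalerDr !scalerA -!fdalg_scaleAr; congr (_ *: _ + _ + _).
exact: mulrC.
Qed.

HB.instance Definition _ :=
  GRing.Lmodule_isLalgebra.Build K B aug_homotope_scaleAl.
HB.instance Definition _ :=
  GRing.Lalgebra_isAlgebra.Build K B aug_homotope_scaleAr.
HB.instance Definition _ := Algebra_isFalgebra.Build K B.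

Definition augmentation (x : B) : K^o := x.1.

Fact augmentation_linear : linear augmentation.
Proof. by []. Qed.
Fact augmentation_monoid_morphism : monoid_morphism augmentation.
Proof. by []. Qed.
HB.instance Definition _ :=
  GRing.isLinear.Build K B K^o *:%R augmentation augmentation_linear.
HB.instance Definition _ :=
  GRing.isMonoidMorphism.Build B K^o augmentation augmentation_monoid_morphism.

Definition aug_ideal : {vspace B} := lker (linfun augmentation).

Lemma aug_idealE x : (x \in aug_ideal) = (augmentation x == 0).
Proof. by rewrite memv_ker lfunE. Qed.

Lemma aug_idealMl x y : y \in aug_ideal -> x * y \in aug_ideal.
Proof. by rewrite !aug_idealE => /eqP y0; rewrite rmorphM /= y0 mulr0. Qed.
Lemma aug_idealMr x y : x \in aug_ideal -> x * y \in aug_ideal.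
Proof. by rewrite !aug_idealE => /eqP x0; rewrite rmorphM /= x0 mul0r. Qed.

Definition left_aug_ideal_pred : {pred B^o} := fun x : B => x \in aug_ideal.
Definition right_aug_ideal_pred : {pred (B^c)^o} :=
  fun x : B => x \in aug_ideal.

Fact left_aug_ideal_closed : subsemimod_closed left_aug_ideal_pred.
Proof.
split; first by split; [exact: mem0v | move=> x y; exact: memvD].
by move=> b x; exact: (@aug_idealMl b x).
Qed.

Fact right_aug_ideal_closed : subsemimod_closed right_aug_ideal_pred.
Proof.
split; first by split; [exact: mem0v | move=> x y; exact: memvD].
by move=> b x; exact: (@aug_idealMr x b).
Qed.

(* The augmentation ideal as a submodule of the regular left (resp. right)
   module B; the scaling in (B^c)^o is b *: x = x * b, computed in B. *)
Definition left_aug_ideal : Type := {x : B^o | left_aug_ideal_pred x}.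
HB.instance Definition _ := SubChoice.on left_aug_ideal.
HB.instance Definition _ := GRing.SubChoice_isSubLmodule.Build B B^o
  left_aug_ideal_pred left_aug_ideal left_aug_ideal_closed.

Definition right_aug_ideal : Type := {x : (B^c)^o | right_aug_ideal_pred x}.
HB.instance Definition _ := SubChoice.on right_aug_ideal.
HB.instance Definition _ := GRing.SubChoice_isSubLmodule.Build B^c (B^c)^o
  right_aug_ideal_pred right_aug_ideal right_aug_ideal_closed.

Lemma left_aug_idealZ (b : B) (x : left_aug_ideal) :
  \val (b *: x) = (b * \val x : B).
Proof. by []. Qed.
Lemma right_aug_idealZ (b : B) (x : right_aug_ideal) :
  \val ((b : B^c) *: x) = ((\val x : B) * b : B).
Proof. by []. Qed.

Definition aug_ideal_mul (x y : subvs_of aug_ideal) : subvs_of aug_ideal :=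
  Subvs (aug_idealMl (vsval x) (subvsP y)).

Fact aug_ideal_mul_bilinear : bilinear_for *:%R *:%R aug_ideal_mul.
Proof.
by split=> z c x y; apply: val_inj; rewrite /= ?mulrDl ?mulrDr -?scalerAl -?scalerAr.
Qed.
HB.instance Definition _ :=
  bilinear_isBilinear.Build K (subvs_of aug_ideal) (subvs_of aug_ideal)
    (subvs_of aug_ideal) *:%R *:%R aug_ideal_mul aug_ideal_mul_bilinear.

Definition multiplication_map :
    tensor_space (subvs_of aug_ideal) (subvs_of aug_ideal) ->
    subvs_of aug_ideal :=
  tensor_lift aug_ideal_mul.
HB.instance Definition _ := GRing.Linear.on multiplication_map.

Lemma multiplication_mapE (x y : subvs_of aug_ideal) :
  vsval (multiplication_map (tensor x y)) = (0, (vsval x).2 * d * (vsval y).2).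
Proof.
rewrite /multiplication_map tensor_liftE /=.
have x0 : (vsval x).1 = 0 by apply/eqP; rewrite -aug_idealE subvsP.
have y0 : (vsval y).1 = 0 by apply/eqP; rewrite -aug_idealE subvsP.
by apply: pair_ext => /=; rewrite x0 ?y0 ?mul0r // !scale0r !add0r.
Qed.

End AugmentedHomotope.

(* Main.v *)
From HB Require Import structures.
Require Import Defs.
From mathcomp Require Import all_boot all_order all_algebra all_field.
Import GRing.Theory.
Local Open Scope ring_scope.

(* Write [I] for the augmentation ideal and [e] for the augmentation, and
   suppose that [I * I] is not [I]. Then some linear form [F] vanishes on
   [I * I] but not at some [x] in [I]. Restricted to [I], it is a map of right
   modules from [I] to [B / I], so by projectivity it lifts to [g : I -> B]
   with [e (g y) = F y]. For any [v] with [e v] nonzero, the element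
   [w = g (v x)] has [e w = F (v x) = e v * F x], again nonzero, and
     [dim wB <= dim vxB < dim vB],
   since [g] maps [vxB] onto [wB], while [vxB] lies in both [vB] and [I] and
   [v] is not in [I]. Starting from [v = 1] this is an infinite descent. *)

(** Subtracting the projection onto [W] kills [W] but not [z], so some coordinate of the difference
    is the required form. *)
Lemma separating_form {K : fieldType} {V : vectType K} {W : {vspace V}} {z : V} :
  z \notin W ->
  exists2 f : {linear V -> K^o}, {in W, forall x, f x = 0} & f z != 0.
Proof.
move=> zW; have q_neq0 : z - projv W z != 0.
  by apply: contra zW; rewrite subr_eq0 => /eqP->; apply: memv_proj.
have [i fz] : exists i, coord (vbasis {:V}) i (z - projv W z) != 0.
  apply/existsP; apply: contraR q_neq0; rewrite negb_exists => /forallP q0.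
  rewrite (coord_vbasis (memvf (z - _))) big1 // => i _.
  by have /negPn/eqP-> := q0 i; rewrite scale0r.
pose f (x : V) : K^o := coord (vbasis {:V}) i (x - projv W x).
have f_lin : linear f.
  by move=> c x y; rewrite /f linearP opprD addrACA -scalerBr linearP.
pose F := GRing.isLinear.Build K V K^o *:%R f f_lin.
pose f' : {linear V -> K^o} := HB.pack f F.
by exists f' => // x xW; rewrite /= /f projv_id // subrr linear0.
Qed.

(** Rank-nullity on the common source [U]. This compares two ranks without constructing the induced
    map between the images. *)
Lemma leq_dim_limg {K : fieldType} {U V W : vectType K}
    {f : 'Hom(U, V)} {g : 'Hom(U, W)} :
  (lker f <= lker g)%VS -> (\dim (limg g) <= \dim (limg f))%N.
Proof.
move=> ker_fg; have := leq_add (dimvS ker_fg) (leqnn (\dim (limg g))).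
have := limg_ker_dim f fullv; have := limg_ker_dim g fullv.
by rewrite !capfv => <- <-; rewrite leq_add2l.
Qed.

Section Residue.
Variable K : fieldType.

(* [K] as a right module over the augmented homotope, via the augmentation. *)
Definition residue (A : fdAlgType K) (d : A) : Type := K^o.

Variables (A : fdAlgType K) (d : A).
Local Notation B := (aug_homotope d).
Local Notation N := (residue A d).
HB.instance Definition _ := GRing.Zmodule.on N.

Definition residue_scale (b : B^c) (c : N) : N := augmentation (b : B) * c.

Fact residue_scaleA (a b : B^c) (c : N) :
  residue_scale a (residue_scale b c) = residue_scale (a * b) c.
Proof. by rewrite /residue_scale mulrA [in RHS]rmorphM /= [X in X * c]mulrC. Qed.

Fact residue_scale1 : left_id 1 residue_scale.
Proof. by move=> c; rewrite /residue_scale rmorph1 mul1r. Qed.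

Fact residue_scaleDr : right_distributive residue_scale +%R.
Proof. by move=> b c c'; rewrite /residue_scale mulrDr. Qed.

Fact residue_scaleDl c : {morph residue_scale^~ c : a b / a + b}.
Proof. by move=> a b; rewrite /residue_scale raddfD mulrDl. Qed.

HB.instance Definition _ := GRing.Zmodule_isLmodule.Build B^c N
  residue_scaleA residue_scale1 residue_scaleDr residue_scaleDl.

(** The quotient map from [B] to [B / I], with [B / I] identified with [K]. *)
Definition residue_map (b : (B^c)^o) : N := augmentation (b : B).

Fact residue_map_linear : linear residue_map.
Proof.
move=> a x y; rewrite /residue_map [LHS]raddfD; congr (_ + _).
by rewrite [LHS]rmorphM mulrC.
Qed.
HB.instance Definition _ :=
  GRing.isLinear.Build B^c (B^c)^o N *:%R residue_map residue_map_linear.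

Lemma sub_augmentation_mem (b : B) :
  b - (augmentation b : K) *: (1 : B) \in aug_ideal d.
Proof.
by rewrite aug_idealE /augmentation /= [_ *: _]mulr1 subrr.
Qed.

Lemma right_aug_ideal_mem (x : right_aug_ideal d) : \val x \in aug_ideal d.
Proof. exact: valP. Qed.

Lemma val_right_aug_idealP (b : B) (x y : right_aug_ideal d) :
  \val ((b : B^c) *: x + y) = (\val x : B) * b + (\val y : B) :> B.
Proof. by []. Qed.

Section Form.
Variable F : {linear B -> K^o}.
Hypothesis F_mul0 : {in aug_ideal d &, forall x y, F (x * y) = 0}.

(** Modulo [I], the element [b] is the scalar [augmentation b], and the remaining part contributes a
    product of two elements of [I], which [F] kills. *)
Lemma form_mull b x : x \in aug_ideal d -> F (b * x) = augmentation b * F x.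
Proof.
move=> xI; rewrite -[b in LHS](subrK ((augmentation b : K) *: (1 : B))).
rewrite mulrDl raddfD /= F_mul0 ?sub_augmentation_mem // add0r -scalerAl mul1r.
exact: linearZ.
Qed.

(** This side makes [F] on [I] a map of right modules; the other one evaluates [F] on [v * x] in the
    descent. *)
Lemma form_mulr b x : x \in aug_ideal d -> F (x * b) = augmentation b * F x.
Proof.
move=> xI; rewrite -[b in LHS](subrK ((augmentation b : K) *: (1 : B))).
rewrite mulrDr raddfD /= F_mul0 ?sub_augmentation_mem // add0r -scalerAr mulr1.
exact: linearZ.
Qed.

Definition form_map (x : right_aug_ideal d) : N := F (\val x : B).

Fact form_map_linear : linear form_map.
Proof.
move=> b x y; rewrite /form_map val_right_aug_idealP raddfD /=.
by rewrite (form_mulr (b : B) (\val x : B) (right_aug_ideal_mem x)).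
Qed.
HB.instance Definition _ :=
  GRing.isLinear.Build B^c (right_aug_ideal d) N *:%R form_map form_map_linear.

Lemma projective_form0 :
  projective (right_aug_ideal d) -> {in aug_ideal d, forall x, F x = 0}.
Proof.
move=> projI x xI; apply/eqP/negPn/negP => Fx_neq0.
have [|g gE] := projI _ _ residue_map form_map.
  by move=> c; exists ((c, 0) : B).
(* [limg (amull v)] is the right ideal [vB]. Induction on a strict bound for its dimension would
   force every augmentation to vanish, which is false for [1]. *)
suff descent n (v : B) :
    (\dim (limg (amull v)) < n)%N -> augmentation v == 0.
  by have := descent _ 1 (ltnSn _); rewrite rmorph1 oner_eq0.
elim: n v => // n IHn v; rewrite ltnS => dim_v; apply/negPn/negP => v_neq0.
have vxI : v * x \in aug_ideal d := aug_idealMl v xI.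
pose y : right_aug_ideal d := Sub (v * x) vxI.
have /negP[] : augmentation (g y : B) != 0.
  have -> : augmentation (g y : B) = augmentation v * F x.
    exact: etrans (gE y) (form_mull v x xI).
  exact: mulf_neq0.
apply: IHn; apply: leq_trans dim_v.
apply: (@leq_ltn_trans (\dim (limg (amull (v * x))))).
  (* With [w = g y], the relation [v * x * b = 0] gives [w * b = g (y b) = 0] by right linearity of
     [g], so [wB] is no larger than [vxB]. *)
  apply/leq_dim_limg/subvP => b; rewrite !memv_ker !lfunE /= => /eqP vxb0.
  have yb0 : (b : B^c) *: y = 0 by apply: val_inj; exact: vxb0.
  have := linearZ_LR g (b : B^c) y.
  by rewrite yb0 linear0 => /esym/eqP.
have v_img : v \in limg (amull v).
  by apply/memv_imgP; exists 1; rewrite ?memvf // lfunE /= mulr1.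
have sub_vx : (limg (amull (v * x)%R) <= limg (amull v))%VS.
  apply/subvP => _ /memv_imgP[b _ ->].
  by apply/memv_imgP; exists (x * b); rewrite ?memvf // !lfunE /= mulrA.
(* Equal dimensions would put [v] in [vxB], hence in [I]. *)
rewrite ltn_neqAle dimvS // andbT; apply: contra v_neq0 => /eqP dim_eq.
have /eqP eq_vx : limg (amull (v * x)) == limg (amull v).
  by rewrite eqEdim sub_vx dim_eq leqnn.
rewrite -aug_idealE; move: v_img; rewrite -eq_vx => /memv_imgP[b _ ->].
by rewrite lfunE /=; apply: aug_idealMr.
Qed.

End Form.
End Residue.

(** The value is a linear combination of terms [a * d * b], and each scalar can be absorbed into the
    left factor [a]. *)
Lemma multiplication_map_generated (K : fieldType) (A : fdAlgType K) (d : A)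
    (t : tensor_space (subvs_of (aug_ideal d)) (subvs_of (aug_ideal d))) :
  generated_ideal d (vsval (multiplication_map t)).2.
Proof.
have idealD := generated_ideal_ideal d.
have add_closed x y : generated_ideal d x -> generated_ideal d y ->
    generated_ideal d (x + y).
  move=> gx gy; rewrite -[y]opprK -[- y]sub0r.
  by apply: (idealB idealD gx); apply: (idealB idealD (ideal0 idealD)).
rewrite /multiplication_map /tensor_lift.
elim/big_rec: _ => [|i u _ gu]; first exact: (ideal0 idealD).
apply: (add_closed _ _ _ gu).
elim/big_rec: _ => [|j w _ gw]; first exact: (ideal0 idealD).
apply: (add_closed _ _ _ gw).
set x := (vbasis _)`_i; set y := (vbasis _)`_j.
have -> : (vsval (t i j *: aug_ideal_mul x y)).2 =
    t i j *: (vsval (multiplication_map (tensor x y))).2.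
  by rewrite /multiplication_map tensor_liftE.
rewrite multiplication_mapE /= !fdalg_scaleAl.
have gd : generated_ideal d d by [].
exact: (Defs.idealMr idealD _ (idealMl idealD _ gd)).
Qed.

Theorem proposition11 (k : closedFieldType) (char0 : [pchar k] =i pred0)
    (A : fdAlgType k) (Delta : A) :
  projective (right_aug_ideal Delta) ->
  projective (left_aug_ideal Delta) ->
  (forall z : subvs_of (aug_ideal Delta),
     exists t : tensor_space (subvs_of (aug_ideal Delta))
                             (subvs_of (aug_ideal Delta)),
       multiplication_map t = z) /\
  (forall a : A, generated_ideal Delta a).
Proof.
move=> projI _.
pose mulI : {linear _ -> _} := @multiplication_map k A Delta.
have mul_onto (z : subvs_of (aug_ideal Delta)) : exists t, mulI t = z.
  (* [W] is [I * I] seen inside [B]. A form that vanishes on it vanishes on all of [I], so it cannot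
     separate [z] from [W]. *)
  pose W := (linfun vsval @: limg (linfun mulI))%VS.
  have [|zW] := boolP (vsval z \in W).
    case/memv_imgP => _ /memv_imgP[t _ ->]; rewrite !lfunE => /val_inj->.
    by exists t.
  have [F F_W /eqP[]] := separating_form zW.
  apply: projective_form0 projI _ (subvsP z) => x y xI yI; apply: F_W.
  have -> : x * y = vsval (mulI (tensor (Subvs xI) (Subvs yI))).
    have -> // : mulI (tensor (Subvs xI) (Subvs yI)) =
        aug_ideal_mul (Subvs xI) (Subvs yI).
    exact: tensor_liftE.
  rewrite -[vsval _]lfunE memv_img // -[mulI _]lfunE memv_img //; exact: memvf.
split=> // a.
(* Every [a] is the second component of an element of [I], so surjectivity carries over to the ideal
   generated by [Delta]. *)
have aI : ((0, a) : aug_homotope Delta) \in aug_ideal Delta.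
  by rewrite aug_idealE.
have [t /(congr1 (fun u => (vsval u).2)) /= <-] := mul_onto (Subvs aI).
exact: multiplication_map_generated.
Qed.
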